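(* Let $n,m,p,q,T\ge 1$ be integers, $\sigma>0$, $A^*\in\mathbb{R}_+^{n\times m}$ with every row of $\ell_1$-norm $1$, $B^*\in\mathbb{R}^{q\times p}$, and let $X_1,\dots,X_T\in\mathbb{R}^{m\times q}$ be fixed design matrices with $Y_t=A^*X_tB^*+E_t$ for $t\in\{1,\dots,T\}$, where all entries of all the matrices $E_t\in\mathbb{R}^{n\times p}$ are i.i.d. $\mathcal N(0,\sigma^2)$. Assume that $\mathbb{X}^\top\mathbb{X}=T\cdot I_{mq}$. Let $\delta\in(0,1)$ and $$\tau:=\sigma\sqrt{\frac{2m}{nT}}\left(\sqrt{\log(2pq)}+\sqrt{\log\left(\tfrac{2}{\delta}\right)}\right),$$ and let $\hat B^S\in\mathbb{R}^{q\times p}$ be the hard-thresholded estimator $[\hat B^S]_{lj}=[\hat B]_{lj}\cdot\mathbf 1_{\{|[\hat B]_{lj}|>2\tau\}}$. Then the following properties hold on the same event, which has probability at least $1-\delta$: 1. If $\|B^*\|_0$ denotes the number of nonzero coefficients in $B^*$, then $\|\hat B^S-B^*\|_F^2< 16\,\|B^*\|_0\,\tau^2$. 2. If the entries of $B^*$ satisfy $\min_{l\in[q],\,j\in[p]}|[B^*]_{lj}|>3\tau$, then the support of $\hat B^S$ perfectly matches that of $B^*$, namely $\mathrm{supp}(\hat B^S)=\mathrm{supp}(B^* )$.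
   Context: $[N]=\{1,\dots,N\}$; $\mathrm{vec}(\cdot)$ denotes column-wise vectorization. $\mathbb{Y}:=(\mathrm{vec}(Y_1),\dots,\mathrm{vec}(Y_T))^\top\in\mathbb{R}^{T\times np}$, $\mathbb{X}:=(\mathrm{vec}(X_1),\dots,\mathrm{vec}(X_T))^\top\in\mathbb{R}^{T\times mq}$, and $\widehat{\mathbb C}:=(\mathbb X^\top\mathbb X)^{-1}\mathbb X^\top\mathbb Y\in\mathbb{R}^{mq\times np}$. For a matrix $\mathbb{G}\in\mathbb{R}^{mq\times np}$, $[\mathbb{G}]_{(k,l)}^{(i,j)}$ denotes the entry in row $k+(l-1)m$ and column $i+(j-1)n$, for $k\in[m]$, $l\in[q]$, $i\in[n]$, $j\in[p]$. The estimator $\hat B\in\mathbb{R}^{q\times p}$ is $[\hat B]_{lj}:=\frac1n\sum_{i=1}^n\sum_{k=1}^m[\widehat{\mathbb C}]_{(k,l)}^{(i,j)}$. $\mathrm{supp}(\cdot)$ denotes the set of indices corresponding to the nonzero entries of a matrix, and $\|\cdot\|_F$ the Frobenius norm.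
   Formalization: In item 1 the strict inequality is asserted only when B* is nonzero; for B* = 0 both sides equal 0, so strictness fails, and the non-strict inequality is proved instead (it holds for every B* ). *)

(* Defs.v *)
From HB Require Import structures.
From mathcomp Require Export all_boot all_order all_algebra.
From mathcomp Require Export all_classical all_reals all_analysis.
Export Order.TTheory GRing.Theory Num.Theory.
Export numFieldNormedType.Exports.

Set Implicit Arguments.
Unset Strict Implicit.
Unset Printing Implicit Defensive.

Local Open Scope classical_set_scope.
Local Open Scope ring_scope.

(* [mxvec] is row-major, so column-wise vectorization goes through the
   transpose. Accordingly the entry (i, j) of an n x p matrix sits at the
   position [mxvec_index j i] of 'I_(p * n): see [val_mxvec_index]. *)
Definition vec (R : Type) (n p : nat) (M : 'M[R]_(n, p)) : 'cV[R]_(p * n) :=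
  (mxvec M^T)^T.

Lemma val_mxvec_index (p n : nat) (j : 'I_p) (i : 'I_n) :
  mxvec_index j i = (i + j * n)%N :> nat.
Proof.
have idx (T1 T2 : eqType) (s1 : seq T1) (s2 : seq T2) x y :
    x \in s1 -> y \in s2 ->
    index (x, y) [seq (a, b) | a <- s1, b <- s2]
    = (index y s2 + index x s1 * size s2)%N.
  move=> + ys2; elim: s1 => //= a s1 IH; rewrite inE index_cat size_map.
  have inj : injective (pair a : T2 -> T1 * T2) by move=> u v [].
  case: eqVneq => [-> _|nax /= xs1].
    by rewrite (mem_map inj) ys2 (index_map inj) mul0n addn0.
  rewrite ifN; last by apply/mapP => -[b _ [xa _]]; rewrite xa eqxx in nax.
  by rewrite IH// mulSn addnCA.
rewrite /mxvec_index /= /enum_rank [enum_rank_in]unlock insubdK; last first.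
  by rewrite unfold_in cardE index_mem mem_enum.
by rewrite enumT unlock /= /prod_enum idx ?mem_enum// !index_enum_ord size_enum_ord.
Qed.

(* Row t is vec(M_t)^T. *)
Definition vec_stack (R : Type) (T n p : nat) (M : 'I_T -> 'M[R]_(n, p)) :
    'M[R]_(T, p * n) :=
  \matrix_(t, c) vec (M t) c 0.

Definition ols (R : realType) (T a b : nat) (X : 'M[R]_(T, a))
    (Y : 'M[R]_(T, b)) : 'M[R]_(a, b) :=
  invmx (X^T *m X) *m X^T *m Y.

Definition Chat (R : realType) (n m p q T : nat)
    (X : 'I_T -> 'M[R]_(m, q)) (Y : 'I_T -> 'M[R]_(n, p)) :
    'M[R]_(q * m, p * n) :=
  ols (vec_stack X) (vec_stack Y).

Definition kl_ij_entry (R : Type) (n m p q : nat) (G : 'M[R]_(q * m, p * n))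
    (k : 'I_m) (l : 'I_q) (i : 'I_n) (j : 'I_p) : R :=
  G (mxvec_index l k) (mxvec_index j i).

Definition Bhat (R : realType) (n m p q T : nat)
    (X : 'I_T -> 'M[R]_(m, q)) (Y : 'I_T -> 'M[R]_(n, p)) : 'M[R]_(q, p) :=
  \matrix_(l, j)
    (n%:R^-1 * \sum_(i < n) \sum_(k < m) kl_ij_entry (Chat X Y) k l i j).

Definition hard_threshold (R : realType) (q p : nat) (c : R) (M : 'M[R]_(q, p)) :
    'M[R]_(q, p) :=
  \matrix_(l, j) (M l j * (c < `|M l j|)%R%:R).

Definition threshold (R : realType) (n m p q T : nat) (sigma delta : R) : R :=
  sigma * Num.sqrt ((2 * m%:R) / (n%:R * T%:R))
  * (Num.sqrt (ln (2 * p%:R * q%:R)) + Num.sqrt (ln (2 / delta))).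

Definition mx_supp (R : realType) (q p : nat) (M : 'M[R]_(q, p)) :
    {set 'I_q * 'I_p} :=
  [set lj | M lj.1 lj.2 != 0]%SET.

Definition l0norm (R : realType) (q p : nat) (M : 'M[R]_(q, p)) : nat :=
  #|mx_supp M|.

(* The norm the library puts on matrices is the sup norm, hence this definition. *)
Definition frobenius (R : realType) (q p : nat) (M : 'M[R]_(q, p)) : R :=
  Num.sqrt (\sum_(l < q) \sum_(j < p) M l j ^+ 2).

Definition mutually_independent (R : realType) (d : measure_display)
    (Omega : measurableType d) (P : probability Omega R) (I : finType)
    (Z : I -> {RV P >-> R}) : Prop :=
  forall (J : {set I}) (S : I -> set R), (forall i, measurable (S i)) ->
    P (\bigcap_(i in [set` J]) (Z i @^-1` S i))
    = (\prod_(i in J) P (Z i @^-1` S i))%E.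

Definition iid_normal (R : realType) (d : measure_display)
    (Omega : measurableType d) (P : probability Omega R) (I : finType)
    (mean sd : R) (Z : I -> {RV P >-> R}) : Prop :=
  mutually_independent Z
  /\ forall (i : I) (S : set R), measurable S ->
       distribution P (Z i) S = normal_prob mean sd S.

(* Main.v *)
From HB Require Import structures.
Require Import Defs.
From mathcomp Require Import measurable_realfun.
From mathcomp Require Import ring lra.

(* Since X^T X = T I, the entry (l, j) of Bhat - B is the linear combination
   of the noise entries E_t(i, j) with weights (1/nT) sum_k X_t(k, l), a
   centred Gaussian whose variance is v = sigma^2 m / (nT). The Chernoff bound
   gives P(|Bhat - B|_(l,j) >= tau) <= 2 exp(- tau^2 / 2v), and
   tau^2 / 2v = (sqrt (ln 2pq) + sqrt (ln (2/delta)))^2 is at least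
   ln 2pq + ln (2/delta), so a union bound over the pq entries leaves an event
   of probability at least 1 - delta on which every entry of Bhat is within
   tau of that of B. On this event, thresholding at 2 tau kills all the entries
   outside the support of B, and commits an error below 3 tau on the others. *)

Set Implicit Arguments.
Unset Strict Implicit.
Unset Printing Implicit Defensive.

Local Open Scope classical_set_scope.
Local Open Scope ring_scope.

(** * Measurability, the union bound and change of variables *)

Lemma measurable_superlevel (R : realType) d (T : measurableType d) (f : T -> R)
    (x : R) :
  measurable_fun setT f -> measurable [set w | x <= f w].
Proof.
move=> mf; rewrite -[X in measurable X]setTI.
have := mf measurableT _ (measurable_itv `[x, +oo[).
by congr (measurable (_ `&` _)); apply/seteqP; split => w /=;
  rewrite in_itv/= andbT.
Qed.

Lemma measure_bigsetU_le (R : realType) d (T : measurableType d)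
    (mu : {measure set T -> \bar R}) (I : finType) (F : I -> set T) :
  (forall i, measurable (F i)) ->
  (mu (\big[setU/set0]_i F i) <= \sum_i mu (F i))%E.
Proof.
(* Measurability is carried along because subadditivity of a union of two sets requires it. *)
move=> mF; suff [] : measurable (\big[setU/set0]_i F i) /\
    (mu (\big[setU/set0]_i F i) <= \sum_i mu (F i))%E by [].
elim/big_ind2 : _ => [|x X y Y [mX leX] [mY leY]|i _]; last by [].
- by rewrite measure0.
- split; first exact: measurableU.
  by apply: le_trans (measureU2 _ mX mY) _; exact: leeD.
Qed.

Import HBNNSimple.

(** Here [nu] is the image under [phi] of the measure with density [h] with respect to [mu]. Taking
    [phi] the identity gives integration against a density, [h] constant equal to 1 gives the law of
    a random variable, and the general case drives the induction on independent factors. Both sides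
    are limits along simple functions increasing to [f]. *)
Lemma ge0_integral_pushforward_density (R : realType) d d' (T : measurableType d)
    (T' : measurableType d') (mu : {measure set T -> \bar R})
    (nu : {measure set T' -> \bar R}) (phi : T -> T') (h : T -> R)
    (f : T' -> R) :
  measurable_fun setT phi -> measurable_fun setT h -> (forall x, 0 <= h x) ->
  (forall S, measurable S ->
     nu S = (\int[mu]_(x in phi @^-1` S) (h x)%:E)%E) ->
  measurable_fun setT f -> (forall y, 0 <= f y) ->
  (\int[nu]_y (f y)%:E = \int[mu]_x (f (phi x) * h x)%:E)%E.
Proof.
move=> mphi mh h0 nuE mf f0.
have mfE : measurable_fun setT (fun y => (f y)%:E) by exact/measurable_EFinP.
pose f_ := nnsfun_approx measurableT mfE.
have f_cvg y : ((f_ n y)%:E @[n --> \oo] --> (f y)%:E)%E.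
  by apply: (cvg_nnsfun_approx measurableT mfE) => // z _; rewrite lee_fin.
have mf_phi n : measurable_fun setT (f_ n \o phi) by exact: measurableT_comp.
transitivity (limn (fun n => \int[nu]_y (f_ n y)%:E)%E).
  rewrite -monotone_convergence//.
  - by apply: eq_integral => y _; exact/esym/cvg_lim.
  - by move=> n; exact/measurable_EFinP.
  - by move=> n y _; rewrite lee_fin.
  - by move=> y _ a b ab; rewrite lee_fin; exact/lefP/nd_nnsfun_approx.
transitivity (limn (fun n => \int[mu]_x (f_ n (phi x) * h x)%:E)%E); last first.
  rewrite -monotone_convergence//.
  - apply: eq_integral => x _; apply/cvg_lim => //.
    under eq_fun do rewrite EFinM.
    by rewrite EFinM; apply: cvgeZr.
  - by move=> n; apply/measurable_EFinP/measurable_funM => //; exact: mf_phi.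
  - by move=> n x _; rewrite lee_fin mulr_ge0.
  - by move=> x _ a b ab; rewrite lee_fin ler_wpM2r//; exact/lefP/nd_nnsfun_approx.
(* For fixed [n], [f_ n] is a finite combination of indicators of level sets, where the hypothesis
   on [nu] applies directly. *)
congr (limn _); apply/funext => n.
have mS r : measurable (f_ n @^-1` [set r]) by [].
have mphiS r : measurable (phi @^-1` (f_ n @^-1` [set r])).
  by rewrite -[_ @^-1` _]setTI; exact: mphi.
under eq_integral do rewrite fimfunE -fsumEFin//.
rewrite ge0_integral_fsum//; last 2 first.
  - by move=> r; exact/measurable_EFinP/measurable_funM.
  - by move=> r x _; rewrite nnfun_muleindic_ge0.
transitivity (\sum_(r \in range (f_ n))
    \int[mu]_x ((r * \1_(f_ n @^-1` [set r]) (phi x))%:E * (h x)%:E))%E.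
  apply: eq_fsbigr => r /[!inE] -[y _ fyr].
  rewrite integralZl_indic_nnsfun// integral_indic// setIT nuE//.
  under [RHS]eq_integral do rewrite EFinM -muleA.
  rewrite ge0_integralZl//; last first.
  - by rewrite -fyr lee_fin.
  - by move=> x _; rewrite mule_ge0 ?lee_fin.
  - apply: emeasurable_funM; last exact/measurable_EFinP.
    by apply/measurable_EFinP/measurableT_comp.
  congr (_ * _)%E; rewrite integral_mkcond; apply: eq_integral => x _.
  by rewrite epatch_indic/= muleC !indicE.
rewrite -ge0_integral_fsum//; last 2 first.
- move=> r; apply: emeasurable_funM; last exact/measurable_EFinP.
  by apply/measurable_EFinP/measurable_funM => //; exact: measurableT_comp.
- by move=> r x _; apply: mule_ge0; rewrite ?lee_fin// -lee_fin EFinM nnfun_muleindic_ge0.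
apply: eq_integral => x _.
rewrite EFinM [in RHS]fimfunE -fsumEFin// ge0_mule_fsuml// => r.
by rewrite nnfun_muleindic_ge0.
Qed.

(** * Expectation of a product of functions of independent variables *)

Section independence.
Context (R : realType) (d : measure_display) (Omega : measurableType d)
  (P : probability Omega R) (I : finType) (Z : I -> {RV P >-> R}).
Hypothesis indepZ : mutually_independent Z.

Let measurable_preimage (i : I) (S : set R) :
  measurable S -> measurable (Z i @^-1` S).
Proof. by move=> mS; rewrite -[_ @^-1` _]setTI; exact: measurable_funP. Qed.

Lemma integral_prod_indic (S : I -> set R) : (forall i, measurable (S i)) ->
  (\int[P]_w (\prod_i \1_(S i) (Z i w))%:E = \prod_i P (Z i @^-1` S i))%E.
Proof.
move=> mS; transitivity (P (\bigcap_(i in [set` [set: I]%SET]) (Z i @^-1` S i))).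
  rewrite -[X in P X]setIT -integral_indic//; last first.
    apply: fin_bigcap_measurable => [|i _]; first exact: finite_finset.
    exact: measurable_preimage.
  apply: eq_integral => w _; congr EFin.
  rewrite indicE; have [wS|] := boolP (w \in _).
    rewrite big1// => i _; rewrite indicE mem_set//.
    by move: wS; rewrite inE => /(_ i); apply; rewrite /= inE.
  rewrite notin_setE => /existsNP[i /not_implyP[_ wSi]].
  by rewrite (bigD1 i)//= indicE memNset// mul0r.
by rewrite indepZ//; apply: eq_bigl => i; rewrite inE.
Qed.

(* The factors are turned one at a time from indicators into arbitrary
   functions; [K] holds the indices that are already arbitrary. *)
Let integral_prod_partial (K : seq I) (f : I -> R -> R) (M : I -> R) :
  (forall i, measurable_fun setT (f i)) -> (forall i x, 0 <= f i x) ->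
  (forall i, \int[P]_w (f i (Z i w))%:E = (M i)%:E)%E ->
  (forall i, i \notin K -> exists2 S, measurable S & f i = \1_S) ->
  (\int[P]_w (\prod_i f i (Z i w))%:E = (\prod_i M i)%:E)%E.
Proof.
elim: K f M => [|k K IH] f M mf f0 fM fS.
  have {}fS i : {S | measurable S & f i = \1_S} by apply/cid2/fS.
  pose S i := s2val (fS i).
  have fE i : f i = \1_(S i) by rewrite /S; case: (fS i).
  have mS i : measurable (S i) by rewrite /S; case: (fS i).
  under eq_integral do under eq_bigr do rewrite fE.
  rewrite integral_prod_indic// -prodEFin; apply: eq_bigr => i _.
  rewrite -fM; under eq_integral do rewrite fE.
  by have := integral_indic P measurableT (@measurable_preimage i _ (mS i));
    rewrite setIT.
have M0 i : 0 <= M i.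
  by rewrite -lee_fin -fM; apply: integral_ge0 => w _; rewrite lee_fin.
pose h w := \prod_(i | i != k) f i (Z i w).
have c0 : 0 <= \prod_(i | i != k) M i by exact: prodr_ge0.
(* The law of [Z k] scaled by the product of the other expectations: by independence it should be
   the image under [Z k] of the measure with density [h]. *)
pose nu := mscale (NngNum c0) (distribution P (Z k)).
have mh : measurable_fun setT h.
  have -> : h = fun w => \prod_(i <- [seq i <- index_enum I | i != k]) f i (Z i w).
    by apply/funext => w; rewrite big_filter.
  by apply: measurable_prod => i _; exact: measurableT_comp.
have h0 w : 0 <= h w by exact: prodr_ge0.
have nuE (S : set R) : measurable S ->
    nu S = (\int[P]_(w in Z k @^-1` S) (h w)%:E)%E.
  move=> mS; have mZS := @measurable_preimage k _ mS.
  (* With [f k] replaced by the indicator of [S], the index [k] may leave the list of arbitrary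
     factors, so the induction hypothesis computes the integral of [h] over the event that [Z k]
     lies in [S]. *)
  pose f' i := if i == k then \1_S else f i.
  pose M' i := if i == k then fine (P (Z k @^-1` S)) else M i.
  have PE : (fine (P (Z k @^-1` S)))%:E = P (Z k @^-1` S).
    by rewrite fineK// fin_num_measure.
  have := IH f' M'; rewrite (bigD1 k)//= /M' eqxx EFinM PE.
  rewrite (eq_bigr M); last by move=> i /negbTE ->.
  rewrite muleC /nu /mscale/= => <-; last first.
  - move=> i iK; rewrite /f'; case: eqVneq => ik; first by exists S.
    by apply: fS; rewrite inE negb_or ik.
  - move=> i; rewrite /f'; case: eqVneq => // ->.
    by rewrite integral_indic// setIT PE.
  - by move=> i x; rewrite /f'; case: eqVneq.
  - by move=> i; rewrite /f'; case: eqVneq.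
  rewrite [RHS]integral_mkcond; apply: eq_integral => w _.
  rewrite epatch_indic/= (bigD1 k)//= /f' eqxx EFinM muleC; congr (_%:E * _)%E.
  by apply: eq_bigr => i /negbTE ->.
transitivity (\int[P]_w (f k (Z k w) * h w)%:E)%E.
  by apply: eq_integral => w _; rewrite (bigD1 k).
rewrite -(ge0_integral_pushforward_density _ mh h0 nuE (mf k) (f0 k))//.
rewrite ge0_integral_mscale//; last first.
- by move=> x _; rewrite lee_fin.
- exact/measurable_EFinP.
rewrite ge0_integral_distribution//=; last first.
- by move=> x; rewrite lee_fin.
- exact/measurable_EFinP.
by rewrite fM [in RHS](bigD1 k)//= mulrC EFinM.
Qed.

Lemma integral_prod_independent (f : I -> R -> R) (M : I -> R) :
  (forall i, measurable_fun setT (f i)) -> (forall i x, 0 <= f i x) ->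
  (forall i, \int[P]_w (f i (Z i w))%:E = (M i)%:E)%E ->
  (\int[P]_w (\prod_i f i (Z i w))%:E = (\prod_i M i)%:E)%E.
Proof.
(* All indices are listed as arbitrary, so no factor has to be an indicator. *)
move=> mf f0 fM; apply: (@integral_prod_partial (enum I)) => // i.
by rewrite mem_enum.
Qed.

End independence.

(** * Gaussian moment generating function and tail bounds *)

Lemma normal_prob_mgf (R : realType) (s l : R) : s != 0 ->
  (\int[normal_prob 0 s]_x (expR (l * x))%:E
   = (expR (l ^+ 2 * s ^+ 2 / 2))%:E)%E.
Proof.
move=> s0.
have mexp : measurable_fun [set: R] (fun x => expR (l * x)).
  by apply: measurableT_comp => //; exact: measurable_funM.
rewrite (@ge0_integral_pushforward_density _ _ _ _ _ lebesgue_measure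
  (normal_prob 0 s) id (normal_pdf 0 s))//; last 2 first.
- exact: measurable_normal_pdf.
- exact: normal_pdf_ge0.
(* Completing the square: tilting by [expR (l * x)] shifts the mean to [l * s ^+ 2] and leaves a
   constant factor. *)
transitivity (\int[lebesgue_measure]_x
    ((expR (l ^+ 2 * s ^+ 2 / 2))%:E * (normal_pdf (l * s ^+ 2) s x)%:E))%E.
  apply: eq_integral => x _; rewrite -EFinM; congr EFin.
  rewrite !normal_pdfE// /normal_fun mulrCA [RHS]mulrCA -!expRD.
  by congr (_ * expR _); field.
rewrite ge0_integralZl//.
- by rewrite integral_normal_pdf mule1.
- by apply/measurable_EFinP; exact: measurable_normal_pdf.
- by move=> x _; rewrite lee_fin normal_pdf_ge0.
Qed.

Section normal_tail.
Context (R : realType) (d : measure_display) (Omega : measurableType d)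
  (P : probability Omega R) (I : finType) (s : R) (Z : I -> {RV P >-> R}).
Hypothesis s_gt0 : 0 < s.
Hypothesis Z_iid : iid_normal 0 s Z.

Lemma measurable_lincomb (a : I -> R) :
  measurable_fun setT (fun w => \sum_i a i * Z i w).
Proof. by apply: measurable_sum => i; exact: measurable_funM. Qed.

(** The exponential of the sum factors over the independent variables. This already suffices for a
    Chernoff bound, without identifying the law of the linear combination. *)
Lemma iid_normal_lincomb_mgf (a : I -> R) :
  (\int[P]_w (expR (\sum_i a i * Z i w))%:E
   = (expR (s ^+ 2 * (\sum_i a i ^+ 2) / 2))%:E)%E.
Proof.
under eq_integral do rewrite expR_sum.
rewrite mulr_sumr mulr_suml expR_sum.
apply: (integral_prod_independent Z_iid.1 (f := fun i x => expR (a i * x))).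
- by move=> i; apply: measurableT_comp => //; exact: measurable_funM.
- by move=> i x; exact: expR_ge0.
move=> i; have [_ Zn] := Z_iid.
have mZ (S : set R) : measurable S -> measurable (Z i @^-1` S).
  by move=> mS; rewrite -[_ @^-1` _]setTI; exact: measurable_funP.
rewrite -[s ^+ 2 * _]mulrC -normal_prob_mgf ?gt_eqF//.
rewrite (@ge0_integral_pushforward_density _ _ _ _ _ P (normal_prob 0 s) (Z i)
  (cst 1))//.
- by apply: eq_integral => w _; rewrite mulr1.
- by move=> _ S mS; rewrite setTI; exact: mZ.
- move=> S mS; transitivity (distribution P (Z i) S); first by rewrite Zn.
  by have /esym := integral_cst P (mZ S mS) 1%:E; rewrite mul1e.
- by apply: measurableT_comp => //; exact: measurable_funM.
Qed.

Lemma iid_normal_lincomb_upper_tail (a : I -> R) (x : R) :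
  let v := s ^+ 2 * \sum_i a i ^+ 2 in 0 < v -> 0 < x ->
  (P [set w | (x <= \sum_i a i * Z i w)%R] <= (expR (- (x ^+ 2 / (v *+ 2))))%:E)%E.
Proof.
move=> v v0 x0.
pose mW := isMeasurableFun.Build _ _ _ _ _ (measurable_lincomb a).
pose W : {RV P >-> R} := HB.pack (fun w => \sum_i a i * Z i w) mW.
(* The parameter [x / v] minimizes the exponent [r ^+ 2 * v / 2 - r * x] over [r]. *)
have := @chernoff _ _ _ P W (x / v) x (divr_gt0 x0 v0).
rewrite /mmt_gen_fun unlock => /le_trans; apply.
rewrite (_ : (\int[P]_w _)%E = (expR ((x / v) ^+ 2 * v / 2))%:E).
  rewrite -EFinM -expRD lee_fin ler_expR (_ : _ + _ = - (x ^+ 2 / (v *+ 2)))//.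
  by field; rewrite gt_eqF.
transitivity (\int[P]_w (expR (\sum_i (x / v * a i) * Z i w))%:E)%E.
  apply: eq_integral => w _; congr (expR _)%:E => /=.
  by rewrite mulrC mulr_sumr; apply: eq_bigr => i _; rewrite mulrA.
rewrite iid_normal_lincomb_mgf; congr (expR (_ / _))%:E.
by under eq_bigr do rewrite exprMn; rewrite -mulr_sumr mulrCA.
Qed.

Lemma iid_normal_lincomb_tail (a : I -> R) (x : R) :
  let v := s ^+ 2 * \sum_i a i ^+ 2 in 0 < v -> 0 < x ->
  (P [set w | (x <= `|\sum_i a i * Z i w|)%R]
   <= (2 * expR (- (x ^+ 2 / (v *+ 2))))%:E)%E.
Proof.
move=> v v0 x0.
have mtail (b : I -> R) : measurable [set w | x <= \sum_i b i * Z i w].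
  exact/measurable_superlevel/measurable_lincomb.
have vN : s ^+ 2 * \sum_i (- a i) ^+ 2 = v.
  by rewrite /v; under eq_bigr do rewrite sqrrN.
(* The lower tail is the upper tail for the weights [- a i], which have the same variance. *)
apply: (@le_trans _ _ (P ([set w | x <= \sum_i a i * Z i w]%R
    `|` [set w | x <= \sum_i (- a i) * Z i w]%R))).
  apply: le_measure; rewrite ?inE; last 1 first.
  - move=> w /=; rewrite ler_normr => /orP[]; first by left.
    rewrite -sumrN => xw; right; congr (_ <= _): xw.
    by apply: eq_bigr => i _; rewrite mulNr.
  - apply: measurable_superlevel.
    by apply: measurableT_comp => //; exact: measurable_lincomb.
  - exact: measurableU.
apply: (le_trans (measureU2 _ (mtail _) (mtail _))).
rewrite mulr_natl mulr2n EFinD; apply: leeD.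
  exact: iid_normal_lincomb_upper_tail.
by have := @iid_normal_lincomb_upper_tail (fun i => - a i) x; rewrite vN; apply.
Qed.

End normal_tail.

(** * Least squares under an orthogonal design *)

Lemma vec_stackE (R : Type) (T n p : nat) (M : 'I_T -> 'M[R]_(n, p)) t j i :
  vec_stack M t (mxvec_index j i) = M t i j.
Proof. by rewrite !mxE mxvecE mxE. Qed.

Lemma eq_mxvec_index (m n : nat) (i i' : 'I_m) (j j' : 'I_n) :
  (mxvec_index i j == mxvec_index i' j') = (i == i') && (j == j').
Proof. by rewrite (inj_eq (@cast_ord_inj _ _ _)) (inj_eq enum_rank_inj). Qed.

Section orthogonal_design.
Context (R : realType) (n m p q T : nat) (X : 'I_T -> 'M[R]_(m, q)).
Hypothesis T_gt0 : (0 < T)%N.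
Hypothesis X_orth : (vec_stack X)^T *m vec_stack X = T%:R *: 1%:M.

Let T_neq0 : T%:R != 0 :> R. Proof. by rewrite pnatr_eq0 -lt0n. Qed.

Lemma orthogonal_design_dot k l k' l' :
  \sum_t X t k l * X t k' l' = T%:R * ((k' == k) && (l' == l))%:R.
Proof.
move/matrixP : X_orth => /(_ (mxvec_index l k) (mxvec_index l' k')).
rewrite !mxE eq_mxvec_index andbC (eq_sym k) (eq_sym l) => <-.
by apply: eq_bigr => t _; rewrite mxE !vec_stackE.
Qed.

Lemma Chat_orthogonalE (Y : 'I_T -> 'M[R]_(n, p)) k l i j :
  kl_ij_entry (Chat X Y) k l i j = T%:R^-1 * \sum_t X t k l * Y t i j.
Proof.
rewrite /kl_ij_entry /Chat /ols X_orth scalemx1 invmx_scalar mul_scalar_mx.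
rewrite -scalemxAl !mxE; congr (_ * _).
by apply: eq_bigr => t _; rewrite mxE !vec_stackE.
Qed.

(** By orthogonality the signal part of each entry of [Chat] is [A i k * B l j]. Summing over [k]
    removes [A], whose rows sum to 1, and averaging over [i] leaves [B l j]. *)
Lemma Bhat_signal_noise (A : 'M[R]_(n, m)) (B : 'M[R]_(q, p))
    (N : 'I_T -> 'M[R]_(n, p)) (l : 'I_q) (j : 'I_p) : (0 < n)%N ->
  (forall i, \sum_k A i k = 1) ->
  Bhat X (fun t => A *m X t *m B + N t) l j
  = B l j + \sum_t \sum_i ((n%:R * T%:R)^-1 * \sum_k X t k l) * N t i j.
Proof.
move=> n_gt0 A1; have n_neq0 : n%:R != 0 :> R by rewrite pnatr_eq0 -lt0n.
have entry i k : kl_ij_entry (Chat X (fun t => A *m X t *m B + N t)) k l i j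
    = A i k * B l j + T%:R^-1 * \sum_t X t k l * N t i j.
  rewrite Chat_orthogonalE.
  under eq_bigr do rewrite mxE mulrDr.
  rewrite big_split mulrDr; congr (_ + _).
  transitivity (T%:R^-1 * \sum_l' \sum_k' A i k' * B l' j
                  * \sum_t X t k l * X t k' l').
    congr (_ * _); under eq_bigr do rewrite mxE mulr_sumr.
    rewrite exchange_big; apply: eq_bigr => l' _.
    under eq_bigr do rewrite mxE mulr_suml mulr_sumr.
    rewrite exchange_big; apply: eq_bigr => k' _; rewrite mulr_sumr.
    by apply: eq_bigr => t _; ring.
  (* Only the term with [l' = l] and [k' = k] survives. *)
  rewrite (bigD1 l)//= [X in _ + X]big1 ?addr0 => [|l' l'l]; last first.
    by rewrite big1// => k' _; rewrite orthogonal_design_dot (negbTE l'l) andbF !mulr0.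
  rewrite (bigD1 k)//= [X in _ + X]big1 ?addr0 => [|k' k'k]; last first.
    by rewrite orthogonal_design_dot (negbTE k'k) !mulr0.
  by rewrite orthogonal_design_dot !eqxx mulr1 mulrC mulfK.
rewrite mxE; under eq_bigr do under eq_bigr do rewrite entry.
under eq_bigr => i _.
  rewrite big_split/= -mulr_suml A1 mul1r -mulr_sumr exchange_big/=.
  under [X in _ + _ * X]eq_bigr do rewrite -mulr_suml.
  over.
rewrite big_split/= sumr_const card_ord -[B l j *+ n]mulr_natl mulrDr mulKf//.
congr (_ + _); rewrite -mulr_sumr exchange_big/= mulrA -invfM mulr_sumr.
apply: eq_bigr => t _; rewrite mulr_sumr; apply: eq_bigr => i _.
by rewrite mulrA.
Qed.

(** Expanding the square, orthogonality kills the products with distinct [k], so the squared sums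
    over [k] add up to [m%:R * T%:R]. The weights do not depend on [i], which contributes a factor
    [n]. *)
Lemma Bhat_noise_sqr (l : 'I_q) : (0 < n)%N ->
  \sum_(t < T) \sum_(i < n) ((n%:R * T%:R)^-1 * \sum_k X t k l) ^+ 2
  = m%:R / (n%:R * T%:R).
Proof.
move=> n_gt0; have n_neq0 : n%:R != 0 :> R by rewrite pnatr_eq0 -lt0n.
under eq_bigr do rewrite sumr_const card_ord exprMn -mulrnAl.
rewrite -mulr_sumr.
have -> : \sum_t (\sum_k X t k l) ^+ 2 = m%:R * T%:R.
  under eq_bigr => t _.
    rewrite expr2 mulr_suml.
    under eq_bigr do rewrite mulr_sumr.
    over.
  rewrite exchange_big/=; under eq_bigr do rewrite exchange_big/=.
  transitivity (\sum_(k < m) T%:R : R).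
    apply: eq_bigr => k _; rewrite (bigD1 k)//= [X in _ + X]big1 ?addr0 => [|k' k'k].
      by rewrite orthogonal_design_dot !eqxx mulr1.
    by rewrite orthogonal_design_dot (negbTE k'k) mulr0.
  by rewrite sumr_const card_ord mulr_natl.
by rewrite -mulr_natl; field; apply/andP.
Qed.

End orthogonal_design.

(** * Deterministic analysis of hard thresholding *)

Section hard_threshold.
Context (R : realType) (q p : nat) (B C : 'M[R]_(q, p)) (tau : R).
Hypothesis CB : forall l j, `|C l j - B l j| < tau.

(** Where [B] vanishes, [C] is below [tau] in absolute value and gets killed. Elsewhere a kept entry
    errs by less than [tau], and a killed one has [B] below [2 * tau + tau], whence the constant
    9. *)
Lemma hard_threshold_entry_err l j :
  ((hard_threshold (2 * tau) C - B) l j) ^+ 2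
  <= (9 * tau ^+ 2) * (B l j != 0)%:R.
Proof.
have := CB l j; rewrite !mxE ltr_norml => /andP[e1 e2].
have tau0 : 0 < tau by lra.
have [B0|B0] := eqVneq (B l j) 0.
  rewrite B0 in e1 e2 *.
  by rewrite ltNge ler_norml (_ : _ && _) ?mulr0 ?subr0 ?expr0n//; lra.
rewrite mulr1; case: ltP => [_|]; rewrite /= ?mulr1 ?mulr0.
  by nra.
by rewrite ler_norml => /andP[h1 h2]; nra.
Qed.

Lemma hard_threshold_frobenius_err :
  frobenius (hard_threshold (2 * tau) C - B) ^+ 2
  <= 9 * (l0norm B)%:R * tau ^+ 2.
Proof.
rewrite sqr_sqrtr; last by do 2!apply: sumr_ge0 => ? _; exact: sqr_ge0.
apply: le_trans (_ : \sum_l \sum_j (9 * tau ^+ 2) * (B l j != 0)%:R <= _).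
  by do 2!apply: ler_sum => ? _; exact: hard_threshold_entry_err.
rewrite pair_big/= -mulr_sumr [leRHS]mulrAC ler_wpM2l//.
  by rewrite mulr_ge0// sqr_ge0.
rewrite -natr_sum ler_nat /l0norm -sum1_card [leqRHS]big_mkcond/=.
by apply: leq_sum => -[l j] _; rewrite inE; case: (_ != _).
Qed.

(** Both supports are full: every entry of [B] is nonzero, and the triangle inequality puts every
    entry of [C] above [3 * tau - tau]. *)
Lemma hard_threshold_supp :
  (forall l j, 3 * tau < `|B l j|) ->
  mx_supp (hard_threshold (2 * tau) C) = mx_supp B.
Proof.
move=> B3; apply/setP => -[l j]; rewrite !inE/= mxE.
have := CB l j; have := B3 l j => h1 h2.
have tau0 : 0 < tau by apply: le_lt_trans h2.
have C2 : 2 * tau < `|C l j|.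
  have := ler_distD (C l j) (B l j) 0.
  rewrite !subr0 distrC => h3; lra.
have -> : B l j != 0 by rewrite -normr_gt0; lra.
by rewrite C2 mulr1 -normr_gt0; lra.
Qed.

End hard_threshold.

(** * Calibration of the threshold *)

Section threshold.
Context (R : realType) (n m p q T : nat) (s delta : R).
Hypotheses (n_gt0 : (0 < n)%N) (m_gt0 : (0 < m)%N) (p_gt0 : (0 < p)%N)
  (q_gt0 : (0 < q)%N) (T_gt0 : (0 < T)%N).
Hypotheses (s_gt0 : 0 < s) (delta_gt0 : 0 < delta) (delta_lt1 : delta < 1).

Let tau := threshold n m p q T s delta.
Let v := s ^+ 2 * (m%:R / (n%:R * T%:R)).

Let pq_ge1 : 1 <= p%:R * q%:R :> R.
Proof. by rewrite -natrM (ler_nat R 1) muln_gt0 p_gt0. Qed.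

Let ln_pq_gt0 : 0 < ln (2 * p%:R * q%:R) :> R.
Proof. by apply: ln_gt0; rewrite -mulrA; have := pq_ge1; lra. Qed.

Let ln_delta_gt0 : 0 < ln (2 / delta).
Proof. by apply: ln_gt0; rewrite ltr_pdivlMr// mul1r (lt_trans delta_lt1)// ltr1n. Qed.

Lemma noise_variance_gt0 : 0 < v.
Proof. by rewrite /v mulr_gt0 ?exprn_gt0 ?divr_gt0 ?mulr_gt0 ?ltr0n. Qed.

Lemma threshold_gt0 : 0 < tau.
Proof.
by rewrite /tau /threshold !mulr_gt0 ?addr_gt0 ?sqrtr_gt0 ?divr_gt0 ?mulr_gt0 ?ltr0n.
Qed.

Lemma threshold_tail :
  2 * expR (- (tau ^+ 2 / (v *+ 2))) <= delta / (p%:R * q%:R).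
Proof.
have v0 := noise_variance_gt0.
have [delta0 pq1] := (delta_gt0, pq_ge1).
have [] := (ln_pq_gt0, ln_delta_gt0).
set a := ln (2 * p%:R * q%:R); set b := ln (2 / delta) => a0 b0.
have -> : tau ^+ 2 / (v *+ 2) = (Num.sqrt a + Num.sqrt b) ^+ 2.
  rewrite /tau /threshold !exprMn sqr_sqrtr; last first.
    by rewrite divr_ge0 ?mulr_ge0 ?ler0n.
  by rewrite /v; field; rewrite ?gt_eqF ?ltr0n.
(* The nonnegative cross term of the square is dropped. *)
apply: (@le_trans _ _ (2 * expR (- (a + b)))).
  rewrite ler_pM2l// ler_expR lerN2 sqrrD !sqr_sqrtr ?(ltW a0) ?(ltW b0)//.
  by rewrite [leRHS]addrAC lerDl mulrn_wge0// mulr_ge0 ?sqrtr_ge0.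
rewrite opprD expRD !expRN /a /b !lnK ?posrE ?divr_gt0 -?mulrA//; last by lra.
have : 0 <= delta / (p%:R * q%:R) by rewrite divr_ge0 ?ltW//; lra.
(* The bound obtained is half of the required one, so a factor 2 is to spare. *)
set x := delta / _ => x0; suff -> : 2 * ((2 * (p%:R * q%:R))^-1 * (2 / delta)^-1) = x / 2.
  by lra.
by rewrite /x; field; rewrite !gt_eqF ?ltr0n.
Qed.

End threshold.

(** * The event of uniformly small errors and its consequences *)

Theorem theorem3p7 (R : realType) (d : measure_display)
    (Omega : measurableType d) (P : probability Omega R)
    (n m p q T : nat)
    (n_ge1 : (1 <= n)%N) (m_ge1 : (1 <= m)%N) (p_ge1 : (1 <= p)%N)
    (q_ge1 : (1 <= q)%N) (T_ge1 : (1 <= T)%N)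
    (sigma : R) (sigma_gt0 : 0 < sigma)
    (A : 'M[R]_(n, m)) (A_ge0 : forall i k, 0 <= A i k)
    (A_row : forall i, \sum_(k < m) `|A i k| = 1)
    (B : 'M[R]_(q, p))
    (X : 'I_T -> 'M[R]_(m, q))
    (E : 'I_T * 'I_n * 'I_p -> {RV P >-> R})
    (E_iid : iid_normal 0 sigma E)
    (Y : 'I_T -> Omega -> 'M[R]_(n, p))
    (Y_def : forall t w,
       Y t w = A *m X t *m B + \matrix_(i, j) E (t, i, j) w)
    (X_orth : (vec_stack X)^T *m vec_stack X = T%:R *: 1%:M)
    (delta : R) (delta_gt0 : 0 < delta) (delta_lt1 : delta < 1) :
  let tau := threshold n m p q T sigma delta in
  let BS := fun w => hard_threshold (2 * tau) (Bhat X (fun t => Y t w)) in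
  exists G : set Omega,
    [/\ measurable G,
        ((1 - delta)%:E <= P G)%E &
        forall w, G w ->
          [/\ (* for B = 0 both sides vanish, so strictness needs B != 0 *)
              frobenius (BS w - B) ^+ 2 <= 16 * (l0norm B)%:R * tau ^+ 2,
              B != 0 ->
              frobenius (BS w - B) ^+ 2 < 16 * (l0norm B)%:R * tau ^+ 2 &
              (forall l j, 3 * tau < `|B l j|) ->
              mx_supp (BS w) = mx_supp B]].
Proof.
move=> tau BS.
have tau0 : 0 < tau by exact: threshold_gt0.
(* The tail bound sums over the whole family [E], so the weights are extended by zero to the columns
   other than [lj.2]. *)
pose a (lj : 'I_q * 'I_p) (e : 'I_T * 'I_n * 'I_p) : R :=
  (n%:R * T%:R)^-1 * (\sum_k X e.1.1 k lj.1) * (e.2 == lj.2)%:R.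
pose W lj w := \sum_e a lj e * E e w.
have BhatE l j w : Bhat X (fun t => Y t w) l j - B l j = W (l, j) w.
  have -> : (fun t => Y t w) = fun t => A *m X t *m B + \matrix_(i, j) E (t, i, j) w.
    by apply/funext => t; exact: Y_def.
  rewrite Bhat_signal_noise// => [|i]; last first.
    by rewrite -(A_row i); apply: eq_bigr => k _; rewrite ger0_norm.
  rewrite addrC addKr pair_big/= /W.
  rewrite (eq_bigr (fun ti => \sum_j' a (l, j) (ti, j') * E (ti, j') w)); last first.
    move=> [t i] _; rewrite (bigD1 j)//= [X in _ + X]big1 ?addr0 => [|j' j'j].
      by rewrite /a/= eqxx mulr1 mxE.
    by rewrite /a/= (negbTE j'j) mulr0 mul0r.
  by rewrite pair_big/=; apply: eq_bigr => -[].
have a_sqr lj : \sum_e a lj e ^+ 2 = m%:R / (n%:R * T%:R).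
  rewrite -(Bhat_noise_sqr T_ge1 X_orth lj.1 n_ge1) pair_big/=.
  rewrite [RHS](eq_bigr (fun ti => \sum_j' a lj (ti, j') ^+ 2)); last first.
    move=> [t i] _; rewrite (bigD1 lj.2)//= [X in _ + X]big1 ?addr0 => [|j' j'j].
      by rewrite /a/= eqxx mulr1.
    by rewrite /a/= (negbTE j'j) mulr0 expr0n.
  by rewrite pair_big/=; apply: eq_bigr => -[].
pose bad lj := [set w | tau <= `|W lj w|].
have mbad lj : measurable (bad lj).
  apply: measurable_superlevel.
  by apply: measurableT_comp => //; exact: measurable_lincomb.
have Pbad lj : (P (bad lj) <= (delta / (p%:R * q%:R))%:E)%E.
  have := iid_normal_lincomb_tail sigma_gt0 E_iid (a := a lj) (x := tau).
  rewrite a_sqr => /(_ (noise_variance_gt0 n_ge1 m_ge1 T_ge1 sigma_gt0) tau0).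
  by move=> /le_trans; apply; rewrite lee_fin; exact: threshold_tail.
(* Outside [U] all entries are accurate at once, so the complement of [U] serves both
   conclusions. *)
pose U := \big[setU/set0]_lj bad lj.
have mU : measurable U by exact: bigsetU_measurable.
exists (~` U); split; first exact: measurableC.
  rewrite probability_setC// EFinB leeB//.
  apply: le_trans (measure_bigsetU_le P mbad) _.
  apply: (@le_trans _ _ (\sum_(lj : 'I_q * 'I_p) (delta / (p%:R * q%:R))%:E)%E).
    by apply: lee_sum => lj _; exact: Pbad.
  (* The [p * q] equal bounds add up to [delta]. *)
  rewrite sumEFin sumr_const card_prod !card_ord lee_fin.
  rewrite -[_ *+ _]mulr_natr mulnC natrM divfK//.
  by rewrite mulf_neq0// pnatr_eq0 -lt0n.
move=> w Uw.
have err l j : `|Bhat X (fun t => Y t w) l j - B l j| < tau.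
  rewrite BhatE ltNge; apply/negP => badw; apply: Uw.
  by rewrite /U -bigcup_seq; exists (l, j) => //=; rewrite mem_index_enum.
have frob := hard_threshold_frobenius_err err.
split.
- by apply: le_trans frob _; rewrite ler_pM2r ?exprn_gt0// ler_wpM2r// ler_nat.
- move=> B0; apply: le_lt_trans frob _.
  (* Strictness comes from 9 being less than 16, once [l0norm B] is positive. *)
  rewrite ltr_pM2r ?exprn_gt0// ltr_pM2r ?ltr_nat// ltr0n lt0n.
  apply: contra B0 => /eqP/cards0_eq supp0; apply/eqP/matrixP => l j.
  have : (l, j) \notin mx_supp B by rewrite supp0 inE.
  by rewrite inE negbK mxE => /eqP.
- exact: hard_threshold_supp.
Qed.
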